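(* Let $\alpha\ge \frac32$. For $z\in\mathbb{H}$ let $\Lambda_z=\frac{1}{\sqrt{\operatorname{Im}(z)}}\big(\mathbb{Z}\oplus z\mathbb{Z}\big)$ and $$\mathcal{R}(\alpha;\Lambda_z)=\sum_{\mathbb{P}\in\Lambda_z}|\mathbb{P}|^4e^{-\pi\alpha|\mathbb{P}|^2}.$$ Then among two-dimensional lattices of unit density (i.e. among the lattices $\Lambda_z$, $z\in\mathbb{H}$) a minimizer of $\mathcal{R}(\alpha;\cdot)$ exists, and the minimum is achieved at the hexagonal lattice, i.e. at $z=e^{i\pi/3}$: $\mathcal{R}(\alpha;\Lambda_z)\ge \mathcal{R}(\alpha;\Lambda_{e^{i\pi/3}})$ for all $z\in\mathbb{H}$.
   Context: $\mathbb{H}=\{z\in\mathbb{C}:\operatorname{Im}(z)>0\}$. Up to rotation, every two-dimensional lattice of unit density (covolume $1$) is of the form $\Lambda_z=\frac{1}{\sqrt{\operatorname{Im}(z)}}(\mathbb{Z}\oplus z\mathbb{Z})\subset\mathbb{C}\cong\mathbb{R}^2$ with $z\in\mathbb{H}$. The hexagonal lattice is the one corresponding to $z=e^{i\pi/3}$. *)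

(* Defs.v *)
From mathcomp Require Import all_boot all_order all_algebra.
From mathcomp Require Import all_classical all_reals all_analysis.
From mathcomp Require Import complex.

Set Implicit Arguments.
Unset Strict Implicit.
Unset Printing Implicit Defensive.

Import Order.TTheory GRing.Theory Num.Theory.
Local Open Scope classical_set_scope.
Local Open Scope complex_scope.
Local Open Scope ring_scope.

Definition upper_half_plane (R : realType) : set R[i] :=
  [set z | 0 < complex.Im z].
Arguments upper_half_plane : clear implicits.

Definition unit_lattice (R : realType) (z : R[i]) : set R[i] :=
  [set P | exists m n : int,
     P = ((Num.sqrt (complex.Im z))^-1)%:C * (m%:~R + n%:~R * z)].

(* The order-4 Gaussian sum of L.  Its terms are nonnegative, so it is the
   unordered sum in [0, +oo]; [normc] is the R-valued modulus. *)
Definition quartic_gaussian_sum (R : realType) (alpha : R) (L : set R[i])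
    : \bar R :=
  \esum_(P in L)
    (Normc.normc P ^+ 4 * expR (- (pi * alpha * Normc.normc P ^+ 2)))%:E.

(* e^{i t}, by Euler's formula. *)
Definition expi (R : realType) (t : R) : R[i] := cos t +i* sin t.

Definition hexagonal_point (R : realType) : R[i] := expi (pi / 3).
Arguments hexagonal_point : clear implicits.

Definition is_minimizer (R : realType) (alpha : R) (z0 : R[i]) : Prop :=
  upper_half_plane R z0 /\
  forall z : R[i], upper_half_plane R z ->
    (quartic_gaussian_sum alpha (unit_lattice z0) <=
     quartic_gaussian_sum alpha (unit_lattice z))%E.

(* Main.v *)
Require Import Defs.
From mathcomp Require Import all_boot all_order all_algebra.
From mathcomp Require Import all_classical all_reals all_analysis.
From mathcomp Require Import complex.
From mathcomp Require Import ring lra zify.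
Import numFieldNormedType.Exports.
Import Order.TTheory GRing.Theory Num.Theory.
Local Open Scope classical_set_scope.
Local Open Scope ring_scope.
(** Call norm of a vector its squared length, scaled so that the shortest vectors
    of the hexagonal lattice get norm 1, and put u = 2 pi alpha / sqrt 3.  Up to a
    factor common to all lattices, the Gaussian sum of a lattice of density one
    becomes the sum of phi u x = x^2 exp (- u (x - 1)) over its norms x.  In
    Selling's coordinates these are the values of
    p k^2 + q l^2 + r (k + l)^2, where pq + qr + rp = 3/4 expresses the density
    and the hexagonal lattice is p = q = r = 1/2.  Selling's reduction allows p,
    q, r to be taken nonnegative up to a small error.

    Put S = p + q + r; then S >= 3/2, with equality only for the hexagonal
    lattice.  Three pairs of opposite vectors have the norms
    x = p + q, p + r, q + r.  For these both the sum of x - 1 and the sum of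
    (x - 1)^2 are functions of S alone, namely 2S - 3 and (S - 3/2)(2S - 1).
    So if phi u lies above the parabola
      1 - (u - 2) (x - 1) + B (x - 1)^2,   B = 2 (u - 2 + 1/20) / (2S - 1),
    which has the same tangent at 1, then the six vectors contribute at least
    6 + (2S - 3)/10 ([phi_ge_parabola], [first_shell_ge]).  Since
    phi'' (1) / 2 = (u^2 - 4u + 2)/2, such a parabola exists near x = 1 as soon
    as u^2 - 6u + 6 > 0, that is u > 3 + sqrt 3 = 4.73...; the hypothesis
    alpha >= 3/2 gives u >= 271/50 = 5.42, which leaves room for the margin 1/20
    and for the whole range of x that occurs.

    The other vectors are compared with the corresponding vectors of the
    hexagonal lattice by the tangent to phi u, after averaging over an
    automorphism of order three of the hexagonal form: the average norm over an
    orbit is 2S/3 times the hexagonal one.  The loss is a multiple of 2S - 3 which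
    is at most the gain (2S - 3)/10, because the weights of the outer shells are
    tiny ([outer_shells_ge]).

    All this needs p + q, p + r, q + r >= 62/100.  If one of them is smaller, then
    the multiples of that single vector already contribute more than the whole
    hexagonal sum, which is at most 6.02 ([gsum_short]). *)

Set Implicit Arguments.
Unset Strict Implicit.
Unset Printing Implicit Defensive.

(** * Bounds for the exponential *)

Section ExpBounds.
Context {R : realType}.
Implicit Types x y u w : R.

(** The mean value theorem between 0 and a point of either sign: the sign of
    [x * c] is what turns a sign condition on [z * df z] into a comparison of
    [f x] with [f 0]. *)
Lemma mean_value_from0 (f df : R -> R) x :
  (forall z, `|z| <= `|x| -> is_derive z (1 : R) f (df z)) -> x != 0 ->
  exists2 c, `|c| <= `|x| /\ 0 < x * c & f x = f 0 + df c * x.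
Proof.
move=> fdf x_neq0.
have dfz z : `|z| <= `|x| -> differentiable f z.
  by move=> zx; apply/derivable1_diffP; case: (fdf z zx).
case: ltgtP x_neq0 => // x0 _.
- have zx z : x <= z <= 0 -> `|z| <= `|x|.
    by move=> /andP[xz z0]; rewrite (ler0_norm z0) (ler0_norm (ltW x0)) lerN2.
  have cf : {within `[x, 0], continuous f}.
    apply: continuous_in_subspaceT => z /[!inE]/= /[!in_itv]/= zx0.
    exact/differentiable_continuous/dfz/zx.
  have [|c] := @MVT _ f df _ _ x0 _ cf; last move=> /[!in_itv]/= /andP[xc c0] E.
    by move=> z /[!in_itv]/= /andP[xz z0]; apply/fdf/zx; rewrite !ltW.
  exists c; last by lra.
  by split; [apply: zx; rewrite !ltW|rewrite nmulr_rgt0].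
- have zx z : 0 <= z <= x -> `|z| <= `|x|.
    by move=> /andP[z0 xz]; rewrite (ger0_norm z0) (ger0_norm (ltW x0)).
  have cf : {within `[0, x], continuous f}.
    apply: continuous_in_subspaceT => z /[!inE]/= /[!in_itv]/= zx0.
    exact/differentiable_continuous/dfz/zx.
  have [|c] := @MVT _ f df _ _ x0 _ cf; last move=> /[!in_itv]/= /andP[c0 cx] E.
    by move=> z /[!in_itv]/= /andP[z0 xz]; apply/fdf/zx; rewrite !ltW.
  exists c; last by lra.
  by split; [apply: zx; rewrite !ltW|rewrite pmulr_rgt0].
Qed.

(** The error of the quadratic Taylor polynomial has the sign of [x], as its
    derivative is nonnegative. *)
Lemma expR_quad_sign x : 0 <= x * (expR x - (1 + x + x ^+ 2 / 2)).
Proof.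
have [->|x0] := eqVneq x 0; first by rewrite mul0r.
pose f y := expR y - (1 + y + y ^+ 2 / 2).
have fdf (z : R) : is_derive z (1 : R) f (expR z - (1 + z)).
  by apply: is_derive_eq => /=; rewrite /GRing.scale /=; lra.
have [c [_ xc]] := mean_value_from0 (fun z _ => fdf z) x0; rewrite /f expR0 => E.
by have := expR_ge1Dx c; nra.
Qed.

(** By [expR_quad_sign] the error of the cubic Taylor polynomial decreases up to 0
    and increases afterwards, so the bound holds for both signs of [x]. *)
Lemma expR_ge_cubic x : 1 + x + x ^+ 2 / 2 + x ^+ 3 / 6 <= expR x.
Proof.
have [->|x0] := eqVneq x 0; first by rewrite expR0; lra.
pose f y := expR y - (1 + y + y ^+ 2 / 2 + y ^+ 3 / 6).
have fdf (z : R) : is_derive z (1 : R) f (expR z - (1 + z + z ^+ 2 / 2)).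
  by apply: is_derive_eq => /=; rewrite /GRing.scale /=; lra.
have [c [_ xc]] := mean_value_from0 (fun z _ => fdf z) x0; rewrite /f expR0 => E.
have := expR_quad_sign c; set g := _ - _ => cg; rewrite -/g in E.
suff : 0 <= g * x by lra.
have : 0 <= (x * c) * (c * g) by rewrite mulr_ge0// ltW.
rewrite (_ : x * c * _ = c ^+ 2 * (g * x)); last by ring.
by rewrite pmulr_rge0// exprn_even_gt0//=; apply: contraTneq xc => ->; rewrite mulr0 ltxx.
Qed.

(** Cubic Taylor bounds are accurate near 0 only; numerical values of [expR] at
    larger points are obtained as powers of such bounds. *)
Lemma expR_ge_pow (n : nat) (y b : R) : 0 <= b -> b <= expR y ->
  b ^+ n <= expR (n%:R * y).
Proof. by move=> b0 hb; rewrite expRM_natl lerXn2r ?nnegrE ?expR_ge0. Qed.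

Lemma expR_ge_220 : 220 <= expR (271 / 50 : R).
Proof.
have -> : 271 / 50 = 16%:R * (271 / 800) :> R by lra.
apply: le_trans (expR_ge_pow 16 _ (expR_ge_cubic _)); lra.
Qed.
End ExpBounds.

(** * Trigonometric values and a lower bound for pi *)

Section Trig.
Context {R : realType}.

Lemma cos_ge_quad (x : R) : 1 - x ^+ 2 / 2 <= cos x.
Proof.
have [->|x0] := eqVneq x 0; first by rewrite cos0; lra.
pose g (y : R) := y - sin y.
have gdg (z : R) : is_derive z (1 : R) g (1 - cos z).
  by apply: is_derive_eq => /=; rewrite /GRing.scale /=; lra.
pose f (y : R) := cos y - (1 - y ^+ 2 / 2).
have fdf (z : R) : is_derive z (1 : R) f (g z).
  by apply: is_derive_eq => /=; rewrite /GRing.scale /= /g; lra.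
have [c [_ xc]] := mean_value_from0 (fun z _ => fdf z) x0; rewrite {1 2}/f cos0 => E.
have c0 : c != 0 by apply: contraTneq xc => ->; rewrite mulr0 ltxx.
have [d _] := mean_value_from0 (fun z _ => gdg z) c0; rewrite {2}/g sin0 => E'.
suff : 0 <= g c * x by lra.
rewrite E'; have := cos_le1 d; nra.
Qed.

(** The triple angle formula at pi/3 reads (c + 1) (2c - 1)^2 = 0. *)
Lemma cos_pi3 : cos (pi / 3) = 1 / 2 :> R.
Proof.
have p0 := @pi_gt0 R.
set c := cos (pi / 3).
have c0 : 0 < c by apply: cos_gt0_pihalf; lra.
have : cos (pi / 3 + pi / 3 + pi / 3) = -1 :> R.
  by rewrite -cospi; congr cos; lra.
have := cos2Dsin2 (pi / 3 : R).
rewrite !cosD !sinD -/c; set s := sin _ => cs E.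
have : (c + 1) * (2 * c - 1) ^+ 2 = 0.
  have -> : (c + 1) * (2 * c - 1) ^+ 2 =
   ((c * c - s * s) * c - (s * c + c * s) * s) + 1 + 3 * c * (c ^+ 2 + s ^+ 2 - 1) by ring.
  rewrite E cs; ring.
move/eqP; rewrite mulf_eq0 sqrf_eq0 => /orP[]/eqP; lra.
Qed.

Lemma sin_pi3 : sin (pi / 3) = Num.sqrt 3 / 2 :> R.
Proof.
have p0 := @pi_gt0 R.
have s0 : 0 < sin (pi / 3) :> R by apply: sin_gt0_pi; lra.
have := cos2Dsin2 (pi / 3 : R); rewrite cos_pi3 => E.
have {}E : 3 = (2 * sin (pi / 3)) ^+ 2 :> R by rewrite exprMn; lra.
by rewrite [X in Num.sqrt X]E sqrtr_sqr gtr0_norm ?mulr_gt0//; lra.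
Qed.

(** Two angle bisections give an upper bound for cos (pi/12), which
    [cos_ge_quad] turns into a lower bound for pi. *)
Lemma pi_ge_313 : 313 / 100 <= pi :> R.
Proof.
have p0 := @pi_gt0 R; have p2 : pi < 4 :> R by have := @pihalf_lt2 R; lra.
have half (x : R) : cos (x + x) = 2 * cos x ^+ 2 - 1.
  by rewrite cosD; have := cos2Dsin2 x; nra.
have c6 : 2 * cos (pi / 6) ^+ 2 - 1 = 1 / 2 :> R.
  by rewrite -half -cos_pi3; congr cos; lra.
have c12 : 2 * cos (pi / 12) ^+ 2 - 1 = cos (pi / 6) :> R.
  by rewrite -half; congr cos; lra.
have c60 : 0 < cos (pi / 6) :> R by apply: cos_gt0_pihalf; lra.
have c120 : 0 < cos (pi / 12) :> R by apply: cos_gt0_pihalf; lra.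
(* 97/112 and 227/235 are small fractions just above the true values. *)
have c6u : cos (pi / 6) <= 97 / 112 :> R by nra.
have c12u : cos (pi / 12) <= 227 / 235 :> R by nra.
have := le_trans (cos_ge_quad (pi / 12 : R)) c12u.
move: (pi : R) p0 => p p0 E; rewrite leNgt; apply/negP => hp.
have : p ^+ 2 < (313 / 100) ^+ 2 by rewrite ltrXn2r// ltW.
lra.
Qed.
End Trig.

(** * The weight of a vector as a function of its norm *)

Section Phi.
Context {R : realType}.
Implicit Types u v x y w : R.

(** Normalized so that the shortest vectors of the hexagonal lattice have weight 1. *)
Definition phi u x : R := x ^+ 2 * expR (- (u * (x - 1))).

Lemma phi_ge0 u x : 0 <= phi u x.
Proof. by rewrite mulr_ge0 ?sqr_ge0 ?expR_ge0. Qed.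

(** With A = u - 2 and P the parabola, the derivative of
    e^(u w) P(w) / (1 + w)^2 is w br(w) times a positive factor, where br is a
    convex quadratic polynomial, negative on the interval at hand.  So the quotient
    is largest at w = 0, where it equals 1. *)
Lemma phi_ge_parabola_near u w : 271 / 50 <= u -> - (38 / 100) <= w -> w <= 37 / 100 ->
  1 - (u - 2) * w + (u - 2 + 1 / 20) * w ^+ 2 <= phi u (1 + w).
Proof.
move=> hu w1 w2.
have [->|w0] := eqVneq w 0; first by rewrite /phi (_ : - (u * _) = 0) ?expR0; [lra|ring].
pose A := u - 2.
pose P z := 1 - A * z + (A + 1 / 20) * z ^+ 2.
pose N z := expR (u * z) * P z.
pose D (z : R) := (1 + z) ^+ 2.
pose f z := N z * (D z)^-1.
pose br z := - (A ^+ 2 - 2 * A - 2) + 1 / 10 + u / 20 * z + (A * (A + 2) + u / 20) * z ^+ 2.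
pose df z := expR (u * z) / (1 + z) ^+ 3 * (z * br z).
have fdf (z : R) : `|z| <= `|w| -> is_derive z (1 : R) f (df z).
  move=> zw; have z1 : 1 + z != 0.
    by move: zw; rewrite ler_norml => /andP[zw _]; have := ler_norm w; case: (ger0P w) zw => ? ? ?; lra.
  have dN : is_derive z (1 : R) N
      (expR (u * z) * (u * P z + 2 * (A + 1 / 20) * z - A)).
    by apply: is_derive_eq; rewrite /GRing.scale /= /P; ring.
  have dD : is_derive z (1 : R) D (2 * (1 + z)).
    by apply: is_derive_eq; rewrite /GRing.scale /=; ring.
  have Dz : D z != 0 by rewrite expf_neq0.
  have dV := is_deriveV Dz dD.
  apply: (is_derive_eq (is_deriveM dN dV)).
  rewrite /GRing.scale /= /df /br /N /D /P.
  move: (expR (u * z)) => e; rewrite (_ : u = A + 2); last by rewrite /A; ring.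
  by field.
have [c [cw wc] E] := mean_value_from0 fdf w0.
have c1 : 0 <= c + 38 / 100 /\ 0 <= 37 / 100 - c.
  by case: (ger0P w) cw => hw; rewrite ler_norml => /andP[? ?]; nra.
(* br is convex: it is enough to look at the ends of the interval. *)
have brc : br c <= 0.
  have A_ge : 342 / 100 <= A by rewrite /A; lra.
  have bra : br (- (38 / 100)) <= 0 by rewrite /br (_ : u = A + 2) /A; nra.
  have brb : br (37 / 100) <= 0 by rewrite /br (_ : u = A + 2) /A; nra.
  have K0 : 0 <= A * (A + 2) + u / 20 by rewrite /A; nra.
  have : (75 / 100) * br c = (37 / 100 - c) * br (- (38 / 100))
    + (c + 38 / 100) * br (37 / 100)
    - (75 / 100) * (A * (A + 2) + u / 20) * ((c + 38 / 100) * (37 / 100 - c)).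
    by rewrite /br; field.
  have := mulr_ge0 c1.1 c1.2; have := mulr_ge0_le0 c1.1 brb.
  have := mulr_ge0_le0 c1.2 bra; nra.
have f0 : f 0 = 1.
  by rewrite /f /N /D /P mulr0 expR0 addr0 expr1n invr1; ring.
have fw : f w <= 1.
  rewrite E f0 -lerBrDl subrr -mulrA mulr_ge0_le0//.
    by rewrite divr_ge0 ?expR_ge0 ?exprn_ge0//; lra.
  by rewrite mulrAC mulr_ge0_le0// mulrC ltW.
have w1_gt0 : 0 < (1 + w) ^+ 2 by rewrite exprn_gt0//; lra.
have := fw; rewrite /f ler_pdivrMr// mul1r => h.
have -> : phi u (1 + w) = (1 + w) ^+ 2 / expR (u * w).
  by rewrite /phi (_ : 1 + w - 1 = w) ?expRN//; ring.
rewrite ler_pdivlMr ?expR_gt0// (mulrC _ (expR _)); move: h; rewrite /N /D /P /A; lra.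
Qed.

(** [phi u] increases up to 2/u and decreases afterwards. *)
Lemma phi_decr u x y : 0 <= x -> 2 <= u * x -> x <= y -> phi u y <= phi u x.
Proof.
move=> x0 ux xy.
have h : y <= x * expR (u * (y - x) / 2).
  apply: le_trans (ler_wpM2l x0 (expR_ge1Dx _)).
  by have : 0 <= (y - x) * (u * x - 2); [apply: mulr_ge0; lra|lra].
have -> : phi u x = (x * expR (u * (y - x) / 2)) ^+ 2 * expR (- (u * (y - 1))).
  rewrite exprMn -expRM_natl -[RHS]mulrA -expRD /phi; congr (_ * expR _); lra.
rewrite /phi ler_wpM2r ?expR_ge0// lerXn2r// ?nnegrE ?mulr_ge0 ?expR_ge0//; lra.
Qed.

Lemma phi_incr u x y : 0 <= x -> u * y <= 2 -> x <= y -> phi u x <= phi u y.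
Proof.
move=> x0 uy xy; have y0 : 0 <= y by lra.
have h : x <= y * expR (- (u * (y - x) / 2)).
  apply: le_trans (ler_wpM2l y0 (expR_ge1Dx _)).
  by have : 0 <= (y - x) * (2 - u * y); [apply: mulr_ge0; lra|lra].
have -> : phi u y = (y * expR (- (u * (y - x) / 2))) ^+ 2 * expR (- (u * (x - 1))).
  rewrite exprMn -expRM_natl -[RHS]mulrA -expRD /phi; congr (_ * expR _); lra.
by rewrite /phi ler_wpM2r ?expR_ge0// lerXn2r// ?nnegrE ?mulr_ge0 ?expR_ge0//.
Qed.

Lemma phi_le_param u v x : u <= v -> x <= 1 -> phi u x <= phi v x.
Proof. by move=> uv x1; rewrite /phi ler_wpM2l ?sqr_ge0// ler_expR; nra. Qed.

(** In the parameter, [phi] is convex, hence above its tangent; this reduces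
    inequalities for all large parameters to a single one. *)
Lemma phi_ge_lin_param u v x : phi u x * (1 - (v - u) * (x - 1)) <= phi v x.
Proof.
have -> : phi v x = phi u x * expR (- ((v - u) * (x - 1))).
  by rewrite /phi -[RHS]mulrA -expRD; congr (_ * expR _); ring.
by rewrite ler_wpM2l ?phi_ge0// expR_ge1Dx.
Qed.

(** Rational lower bounds for [phi]: the exponent is cut into 16 pieces, short
    enough for the cubic Taylor polynomial. *)
Lemma phi_ge_cubic_pow u x c (y := - (u * (x - 1)) / 16) (b := 1 + y + y ^+ 2 / 2 + y ^+ 3 / 6) :
  0 <= b -> c <= x ^+ 2 * b ^+ 16 -> c <= phi u x.
Proof.
move=> b0 /le_trans; apply; rewrite ler_wpM2l ?sqr_ge0//.
rewrite (_ : - (u * _) = 16%:R * y); last by rewrite /y; lra.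
exact/expR_ge_pow/expR_ge_cubic.
Qed.

(** Below 1, [phi] increases with the parameter, so u = 271/50 is the worst case;
    there unimodality leaves the two ends of the interval. *)
Lemma phi_ge_single u x : 271 / 50 <= u -> 21 / 100 <= x -> x <= 62 / 100 ->
  3011 / 1000 <= phi u x.
Proof.
move=> hu x1 x2; apply: le_trans (phi_le_param hu _); last lra.
have [h|h] := lerP (271 / 50 * x) 2.
  apply: le_trans (phi_incr _ h x1); last lra.
  by apply: phi_ge_cubic_pow; lra.
apply: le_trans (phi_decr _ (ltW h) x2); last lra.
by apply: phi_ge_cubic_pow; lra.
Qed.

Lemma phi_ge_double u x : 271 / 50 <= u -> 155 / 1000 <= x -> x <= 21 / 100 ->
  3011 / 1000 <= phi u x + phi u (4 * x).
Proof.
move=> hu x1 x2.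
have h1 : 2 <= phi u x.
  apply: le_trans (phi_le_param hu _); last lra.
  apply: le_trans (phi_incr _ _ x1); try lra.
  by apply: phi_ge_cubic_pow; lra.
have h2 : 3 / 2 <= phi u (4 * x).
  apply: le_trans (phi_le_param hu _); last lra.
  have h : 4 * x <= 84 / 100 by lra.
  apply: le_trans (phi_decr _ _ h); try lra.
  by apply: phi_ge_cubic_pow; lra.
lra.
Qed.

(** Certificates for the cubic inequalities of the next lemma: a cubic which is
    concave on an interval is a chord plus a nonnegative combination of these
    products. *)
Lemma interval_products a b x : a <= x -> x <= b ->
  0 <= (x - a) * (b - x) /\ 0 <= (x - a) * ((x - a) * (b - x)).
Proof. by move=> ax xb; rewrite !mulr_ge0 ?subr_ge0. Qed.

(** The coefficient 4 x / D of the square is what 2 / (2S - 1) becomes when S is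
    replaced by its least possible value, given that x is one of the three norms:
    then the other two are equal and S = (3 x^2 + 3) / (4 x).  The right-hand side
    is 1 - (u - 2) T + E / 20, affine in u, so [phi_ge_lin_param] reduces the claim
    to u = 271/50.  There the interval is cut so finely that on each piece a
    constant separates the two sides. *)
Lemma phi_ge_parabola_far u x (D := 3 * x ^+ 2 - 2 * x + 3) :
  271 / 50 <= u -> 137 / 100 <= x -> x <= 184 / 100 ->
  1 - (u - 2) * (x - 1) + (u - 2 + 1 / 20) * (4 * x / D) * (x - 1) ^+ 2 <= phi u x.
Proof.
move=> hu x1 x2.
have D0 : 0 < D by rewrite /D; nra.
pose T := (x - 1) * (3 - x) * (x + 1) / D.
pose E := 4 * x * (x - 1) ^+ 2 / D.
have -> : 1 - (u - 2) * (x - 1) + (u - 2 + 1 / 20) * (4 * x / D) * (x - 1) ^+ 2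
    = 1 - (u - 2) * T + E / 20.
  by rewrite /T /E /D; field; rewrite -/D gt_eqF.
pose v : R := 271 / 50.
have hT : (x - 1) * phi v x <= T.
  have e : 1 + v * (x - 1) + (v * (x - 1)) ^+ 2 / 2 <= expR (v * (x - 1)).
    have := expR_quad_sign (v * (x - 1)); rewrite pmulr_rge0 ?subr_ge0//.
    by rewrite mulr_gt0// /v; lra.
  have T1 : 24 / 100 <= T by rewrite /T ler_pdivlMr// /D; have := interval_products x1 x2; lra.
  rewrite /phi expRN mulrA ler_pdivrMr ?expR_gt0//.
  apply: le_trans (ler_pM _ _ T1 e); [|lra|rewrite /v; nra].
  have : 0 <= (x - 1) ^+ 2 * (2 - x) by rewrite mulr_ge0 ?sqr_ge0; lra.
  by have := sqr_ge0 (x - 1); rewrite /v; lra.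
apply: le_trans (phi_ge_lin_param v u x).
suff h : 1 - (v - 2) * T + E / 20 <= phi v x.
  have uv : 0 <= (u - v) * (T - (x - 1) * phi v x).
    by apply: mulr_ge0; [rewrite /v|]; lra.
  lra.
have RHSle c : D - (v - 2) * ((x - 1) * (3 - x) * (x + 1)) + x * (x - 1) ^+ 2 / 5 <= c * D ->
   1 - (v - 2) * T + E / 20 <= c.
  move=> h; rewrite -(ler_pM2r D0) (_ : _ * D = D - (v - 2) * ((x - 1) * (3 - x) * (x + 1)) + x * (x - 1) ^+ 2 / 5)//.
  by rewrite /T /E; field; rewrite gt_eqF.
(* [phi v] decreases, so on [a, b] it is at least its value at b. *)
have piece a b c : 1 <= a -> a <= x -> x <= b -> c <= phi v b ->
   D - (v - 2) * ((x - 1) * (3 - x) * (x + 1)) + x * (x - 1) ^+ 2 / 5 <= c * D ->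
   1 - (v - 2) * T + E / 20 <= phi v x.
  move=> a1 ax xb cb /RHSle/le_trans; apply; apply: le_trans cb _.
  by apply: phi_decr; rewrite /v; lra.
rewrite /v in piece *; rewrite /D in piece.
have [h1|h1] := lerP x (143 / 100).
  apply: (piece (137 / 100) (143 / 100) (19 / 100)) => //; [lra|by apply: phi_ge_cubic_pow; lra|].
  have := interval_products x1 h1; lra.
have [h2|h2] := lerP x (155 / 100).
  apply: (piece (143 / 100) (155 / 100) (118 / 1000)) => //; [lra|lra|by apply: phi_ge_cubic_pow; lra|].
  have := interval_products (ltW h1) h2; lra.
have [h3|h3] := lerP x (165 / 100).
  apply: (piece (155 / 100) (165 / 100) (6 / 100)) => //; [lra|lra|by apply: phi_ge_cubic_pow; lra|].
  have := interval_products (ltW h2) h3; lra.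
apply: (piece (165 / 100) (184 / 100) (32 / 1000)) => //; [lra|lra|by apply: phi_ge_cubic_pow; lra|].
have := interval_products (ltW h3) x2; lra.
Qed.
End Phi.

(** * The first shell *)

Section Shells.
Context {R : realType}.
Implicit Types u x y w p q r : R.

(** The last hypothesis says that S is at least its minimum (3 x^2 + 3) / (4 x) over
    the triples containing the norm x. *)
Lemma phi_ge_parabola u S x : 271 / 50 <= u -> 3 <= 2 * S ->
  62 / 100 <= x -> x <= 184 / 100 -> 3 * x ^+ 2 + 3 <= 4 * x * S ->
  1 - (u - 2) * (x - 1) + 2 * (u - 2 + 1 / 20) / (2 * S - 1) * (x - 1) ^+ 2 <= phi u x.
Proof.
move=> hu hS x1 x2 hxS.
have A0 : 0 <= u - 2 + 1 / 20 by lra.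
have S0 : 0 < 2 * S - 1 by lra.
have [h|h] := lerP x (137 / 100).
  rewrite (_ : phi u x = phi u (1 + (x - 1))); last by congr phi; ring.
  apply: le_trans (phi_ge_parabola_near hu _ _); [|lra|lra].
  rewrite lerD2l ler_wpM2r ?sqr_ge0// ler_pdivrMr//; nra.
apply: le_trans (phi_ge_parabola_far hu (ltW h) x2).
rewrite lerD2l ler_wpM2r ?sqr_ge0//.
rewrite (_ : 2 * _ / _ = (u - 2 + 1 / 20) * (2 / (2 * S - 1))); last by ring.
rewrite ler_wpM2l//.
have D0 : 0 < 3 * x ^+ 2 - 2 * x + 3 by nra.
by rewrite ler_pdivrMr// mulrAC ler_pdivlMr//; lra.
Qed.

Lemma selling_sum_ge p q r : p * q + q * r + r * p = 3 / 4 ->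
  0 < p + q -> 0 < p + r -> 0 < q + r -> 3 <= 2 * (p + q + r).
Proof.
move=> D h1 h2 h3; have := sqr_ge0 (p - q); have := sqr_ge0 (p - r).
by have := sqr_ge0 (q - r); nra.
Qed.

(** Sum the parabola of [phi_ge_parabola] over the three norms: the linear and
    quadratic terms depend on S only, and B is chosen such that everything cancels
    except the margin 1/20 times 2S - 3. *)
Lemma first_shell_ge u p q r : 271 / 50 <= u -> p * q + q * r + r * p = 3 / 4 ->
  62 / 100 <= p + q -> 62 / 100 <= p + r -> 62 / 100 <= q + r ->
  p + q <= 184 / 100 -> p + r <= 184 / 100 -> q + r <= 184 / 100 ->
  3 + (2 * (p + q + r) - 3) / 20 <= phi u (p + q) + phi u (p + r) + phi u (q + r).
Proof.
move=> hu D h1 h2 h3 k1 k2 k3; set S := p + q + r.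
have hS : 3 <= 2 * S by apply: selling_sum_ge; lra.
have S0 : 2 * S - 1 != 0 by apply: lt0r_neq0; lra.
have e1 := phi_ge_parabola hu hS h1 k1.
have e2 := phi_ge_parabola hu hS h2 k2.
have e3 := phi_ge_parabola hu hS h3 k3.
have {}e1 := e1 ltac:(rewrite /S; have := sqr_ge0 (p - q); lra).
have {}e2 := e2 ltac:(rewrite /S; have := sqr_ge0 (p - r); lra).
have {}e3 := e3 ltac:(rewrite /S; have := sqr_ge0 (q - r); lra).
apply: le_trans (lerD (lerD e1 e2) e3).
rewrite le_eqVlt; apply/orP; left; apply/eqP.
set B := _ / (2 * S - 1).
have EB : B * ((S - 3 / 2) * (2 * S - 1)) = 2 * (u - 2 + 1 / 20) * (S - 3 / 2).
  by rewrite /B; field.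
have EQ : (p + q - 1) ^+ 2 + (p + r - 1) ^+ 2 + (q + r - 1) ^+ 2 = (S - 3 / 2) * (2 * S - 1).
  by rewrite /S; lra.
have -> : forall a b c, 1 - (u - 2) * (p + q - 1) + B * a + (1 - (u - 2) * (p + r - 1) + B * b)
   + (1 - (u - 2) * (q + r - 1) + B * c) = 3 - (u - 2) * (2 * S - 3) + B * (a + b + c).
  by move=> a b c; rewrite /S; ring.
by rewrite EQ EB; lra.
Qed.

(** From (p + q - a) (p + r - a) >= 0 with a = 62/100 the sum of the two smaller
    norms is at most a + (p + q) (p + r) / a, and (p + q) (p + r) = 3/4 + p^2. *)
Lemma reduced_bounds p q r : p * q + q * r + r * p = 3 / 4 ->
  p <= q -> p <= r -> - (1 / 1000) <= p -> 62 / 100 <= p + q -> 62 / 100 <= p + r ->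
  p + q + r <= 15 / 8 /\ q + r <= 184 / 100.
Proof.
move=> D pq pr p0 h1 h2.
have p1 : p <= 1 / 2 by rewrite leNgt; apply/negP => hp; nra.
have := mulr_ge0 (_ : 0 <= p + q - 62 / 100) (_ : 0 <= p + r - 62 / 100).
move=> /(_ ltac:(lra) ltac:(lra)) h.
have hp : 0 <= (p + 1 / 1000) * (1 / 2 - p) by apply: mulr_ge0; lra.
by split; nra.
Qed.

(** The tangent to [phi u] at N lies below [phi u] on the whole range y >= N / 2,
    not only where [phi u] is convex.  In terms of y = N (1 + w) and U = u N this is
    (1 + w)^2 e^(- U w) >= 1 - (U - 2) w. *)
Lemma phi_ge_tangent u N y : 271 / 50 <= u -> 3 <= N -> N / 2 <= y ->
  phi u N - (y / N - 1) * ((u * N - 2) * phi u N) <= phi u y.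
Proof.
move=> hu hN hy.
have N0 : N != 0 by apply: lt0r_neq0; lra.
pose w := y / N - 1; pose U := u * N.
have yE : y = N * (1 + w) by rewrite /w; field.
have hw : - (1 / 2) <= w.
  have : 1 / 2 <= y / N by rewrite ler_pdivlMr; lra.
  by rewrite /w; lra.
have hU : 16 <= U by rewrite /U; nra.
have -> : phi u y = phi u N * ((1 + w) ^+ 2 * expR (- (U * w))).
  rewrite /phi yE exprMn [RHS]mulrACA -expRD /U; congr (_ * expR _); ring.
rewrite -/w -/U (_ : _ - _ = phi u N * (1 - (U - 2) * w)); last by ring.
rewrite ler_wpM2l ?phi_ge0//.
have [w0|w0] := lerP 0 w; last first.
  (* here e^(- U w) is at least its quadratic Taylor polynomial *)
  have := expR_quad_sign (- (U * w)); rewrite pmulr_rge0; last by nra.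
  rewrite subr_ge0 => h; apply: le_trans (ler_wpM2l (sqr_ge0 _) h).
  suff : 0 <= w ^+ 2 * (1 - 2 * U + U ^+ 2 / 2 - w * (U - U ^+ 2) + w ^+ 2 * U ^+ 2 / 2) by lra.
  rewrite mulr_ge0 ?sqr_ge0//.
  have : 0 <= (w + 1 / 2) * (U ^+ 2 - U) by rewrite mulr_ge0//; nra.
  nra.
have [h|h] := lerP ((U - 2) * w) 1; last first.
  by apply: le_trans (_ : 0 <= _); [lra|rewrite mulr_ge0 ?sqr_ge0 ?expR_ge0].
(* Now U w < 2, and e^(- U w) is at least (1 - U w / 2)^2. *)
have e : 0 <= 1 - U * w / 2 <= expR (- (U * w / 2)).
  by rewrite -[X in _ && X]/(1 + - (U * w / 2) <= _) expR_ge1Dx; nra.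
rewrite (_ : - (U * w) = 2%:R * (- (U * w / 2))); last by field.
rewrite expRM_natl -exprMn.
have : ((1 + w) * (1 - U * w / 2)) ^+ 2 <= ((1 + w) * expR (- (U * w / 2))) ^+ 2.
  case/andP: e => e1 e2.
  rewrite lerXn2r// ?nnegrE ?mulr_ge0 ?expR_ge0 ?ler_wpM2l//; lra.
apply: le_trans.
suff : 0 <= w ^+ 2 * ((U - 2) ^+ 2 / 4 - U + (U - 2) * U / 2 * w + U ^+ 2 / 4 * w ^+ 2) by lra.
rewrite mulr_ge0 ?sqr_ge0// addr_ge0//; last by rewrite mulr_ge0 ?sqr_ge0// divr_ge0 ?sqr_ge0.
rewrite addr_ge0//; first by nra.
rewrite mulr_ge0//; nra.
Qed.
End Shells.

(** * Summing the tail *)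

Section Tail.
Context {R : realType}.
Local Open Scope ereal_scope.

Lemma esum_half_nat (b : R) : (0 <= b)%R ->
  \esum_(n in [set: nat]) (b * 2^-1 ^+ n)%:E <= (2 * b)%:E.
Proof.
move=> b0; have t0 n : 0 <= (b * 2^-1 ^+ n)%:E by rewrite lee_fin mulr_ge0// exprn_ge0.
rewrite -nneseries_esumT//.
apply: lime_le; first exact: is_cvg_nneseries.
apply: nearW => n; rewrite sumEFin lee_fin.
suff -> : (\sum_(0 <= i < n) b * 2^-1 ^+ i = 2 * b - 2 * b * 2^-1 ^+ n)%R.
  by rewrite gerBl mulr_ge0 ?exprn_ge0 ?mulr_ge0.
elim: n => [|n IH]; first by rewrite big_nil expr0; ring.
by rewrite big_nat_recr//= IH exprS; field.
Qed.

(** The nonnegative and the negative integers contribute at most [2 * b] and [b]. *)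
Lemma esum_half_int (b : R) : (0 <= b)%R ->
  \esum_(n in [set: int]) (b * 2^-1 ^+ `|n|%N)%:E <= (3 * b)%:E.
Proof.
move=> b0; have t0 (n : int) : 0 <= (b * 2^-1 ^+ `|n|%N)%:E.
  by rewrite lee_fin mulr_ge0// exprn_ge0.
rewrite (esumID (range Posz))// !setTI.
rewrite (_ : ~` range Posz = range Negz); last first.
  apply/seteqP; split=> [[n|n]/= h|_ [n _ <-] [m _]//]; last by exists n.
  by exfalso; apply: h; exists n.
rewrite !esum_image; try by move=> x y _ _ [].
have -> : (3 * b = 2 * b + 2 * (b / 2))%R by field.
rewrite EFinD leeD// ?esum_half_nat//.
rewrite (eq_esum (b := fun n => (b / 2 * 2^-1 ^+ n)%:E)); last first.
  by move=> n _ /=; rewrite exprS mulrA.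
by rewrite esum_half_nat// divr_ge0.
Qed.

Lemma esum_half_int2 (b : R) : (0 <= b)%R ->
  \esum_(v in [set: int * int]) (b * 2^-1 ^+ (`|v.1| + `|v.2|)%N)%:E <= (9 * b)%:E.
Proof.
move=> b0.
have -> : [set: int * int] = [set: int] `*`` (fun=> [set: int]) by apply/seteqP.
rewrite -(@esum_esum _ _ _ _ _ (fun i j => (b * 2^-1 ^+ (`|i| + `|j|)%N)%:E))/=; last first.
  by move=> i j _ _; rewrite lee_fin mulr_ge0// exprn_ge0.
apply: (@le_trans _ _ (\esum_(i in [set: int]) (3 * b * 2^-1 ^+ `|i|%N)%:E)).
  apply: le_esum => i _; rewrite -mulrA.
  apply: le_trans (esum_half_int _); last by rewrite mulr_ge0// exprn_ge0.
  by apply: le_esum => j _; rewrite exprD mulrA.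
have -> : (9 * b = 3 * (3 * b))%R by ring.
by apply: esum_half_int; rewrite mulr_ge0.
Qed.
End Tail.

Section TailTerm.
Context {R : realType}.
Implicit Types u : R.

(** 220 is a lower bound for e^(271/50), see [expR_ge_220]. *)
Lemma cubic_lt_geom (m : nat) :
  542 / 100 * (m%:R + 3) ^+ 3 * 2 ^+ (m + 3) <= 3 / 100 * 220 ^+ (m + 2) :> R.
Proof.
elim: m => [|m IH]; first by rewrite add0r; lra.
have m0 : 0 <= m%:R :> R by [].
rewrite -natr1 !addSn !exprS.
have h : (m%:R + 1 + 3) ^+ 3 <= 3 * (m%:R + 3) ^+ 3 :> R by nra.
have p2 : 0 <= 2 ^+ (m + 3) :> R by rewrite exprn_ge0.
have := mulr_ge0 p2 (_ : 0 <= 3 * (m%:R + 3) ^+ 3 - (m%:R + 1 + 3) ^+ 3 :> R).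
move=> /(_ ltac:(lra)).
have : 0 <= 220 ^+ (m + 2) :> R by rewrite exprn_ge0.
lra.
Qed.

(** The left-hand side is the coefficient of the relative displacement in
    [phi_ge_tangent], at a hexagonal vector of norm n; it decays fast enough to be
    summed as a product of geometric series. *)
Lemma outer_term_le u (n : nat) : 271 / 50 <= u -> (3 <= n)%N ->
  (u * n%:R - 2) * phi u n%:R <= 3 / 100 * 2^-1 ^+ n.
Proof.
move=> hu n3; rewrite -(subnK n3); move: (n - 3)%N => m {n n3}.
set n : R := (m + 3)%:R.
have nE : n = m%:R + 3 by rewrite /n natrD.
have m0 : 0 <= m%:R :> R by [].
(* u e^(- u (n - 1)) decreases in u, so u = 271/50 is the worst case. *)
have u1 : u * expR (- (u * (n - 1))) <= 271 / 50 * expR (- (271 / 50 * (n - 1))).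
  rewrite (_ : - (271 / 50 * (n - 1)) = (u - 271 / 50) * (n - 1) - u * (n - 1)); last by ring.
  rewrite expRD mulrA ler_wpM2r ?expR_ge0//.
  have := expR_ge1Dx ((u - 271 / 50) * (n - 1)).
  have : 0 <= (u - 271 / 50) * (n - 2) by rewrite mulr_ge0//; lra.
  by lra.
have e1 : expR (- (271 / 50 * (n - 1))) <= (220 ^+ (m + 2))^-1 :> R.
  rewrite expRN lef_pV2 ?posrE ?expR_gt0 ?exprn_gt0//.
  rewrite (_ : _ * (n - 1) = (m + 2)%:R * (271 / 50)); last by rewrite nE natrD; lra.
  by apply: expR_ge_pow => //; exact: expR_ge_220.
apply: (@le_trans _ _ (n ^+ 3 * (u * expR (- (u * (n - 1)))))).
  rewrite /phi; set e := expR _; have e0 : 0 <= e by exact: expR_ge0.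
  by have := mulr_ge0 e0 (sqr_ge0 n); lra.
apply: (@le_trans _ _ (n ^+ 3 * (271 / 50 * (220 ^+ (m + 2))^-1))).
  by rewrite ler_wpM2l ?exprn_ge0//; lra.
rewrite mulrA ler_pdivrMr ?exprn_gt0// exprVn.
rewrite [leRHS](_ : _ = 3 / 100 * 220 ^+ (m + 2) / 2 ^+ (m + 3)); last by ring.
rewrite ler_pdivlMr ?exprn_gt0//.
by have := cubic_lt_geom m; rewrite nE; lra.
Qed.
End TailTerm.

(** * The hexagonal form *)

Section Eis.
Implicit Types v : int * int.

(** The norms of the hexagonal lattice. *)
Definition hexnorm v : int := v.1 ^+ 2 + v.1 * v.2 + v.2 ^+ 2.
Definition small_vectors : seq (int * int) :=
  [:: (0, 0); (1, 0); (-1, 0); (0, 1); (0, -1); (1, -1); (-1, 1)].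
(** As [hexnorm] never takes the value 2, these are the vectors beyond the first shell. *)
Definition outer_shells : set (int * int) := [set v | 3 <= hexnorm v].
(** A rotation of order three of the hexagonal lattice. *)
Definition turn v : int * int := (v.2, - (v.1 + v.2)).

Lemma turn3 v : turn (turn (turn v)) = v.
Proof. by case: v => k l; rewrite /turn /=; congr pair; ring. Qed.

Lemma hexnorm_turn v : hexnorm (turn v) = hexnorm v.
Proof. by case: v => k l; rewrite /turn /hexnorm /=; ring. Qed.

Lemma turn_bij : set_bij outer_shells outer_shells turn.
Proof.
split=> [v|v w _ _ e|v hv]; first by rewrite /outer_shells /= hexnorm_turn.
  by rewrite -(turn3 v) e turn3.
by exists (turn (turn v)); rewrite ?turn3// /outer_shells /= !hexnorm_turn.
Qed.

Lemma outer_shellsC : ~` outer_shells = [set` small_vectors].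
Proof.
apply/seteqP; split=> [[k l]|v]; rewrite /outer_shells /small_vectors /hexnorm /=.
  move=> /negP; rewrite -ltNge => h.
  have : (2 * k + l) ^+ 2 + 3 * l ^+ 2 < 12 by nia.
  have : (2 * l + k) ^+ 2 + 3 * k ^+ 2 < 12 by nia.
  move=> h1 h2.
  have hk : -1 <= k <= 1 by nia.
  have hl : -1 <= l <= 1 by nia.
  have : k \in [:: -1; 0; 1] by rewrite !inE; lia.
  have : l \in [:: -1; 0; 1] by rewrite !inE; lia.
  by rewrite !inE; do 2![case/or3P => /eqP ?]; subst k l.
by rewrite !inE; do 6![case/predU1P => [->//|]]; move/eqP=> ->.
Qed.

(** In general (|k| + |l|)^2 <= 4 n; for n >= 4 this gives |k| + |l| <= n at once,
    and for n = 3 because |k| + |l| is an integer.  On the first shell the bound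
    fails, for instance at (1, -1). *)
Lemma l1_le_hexnorm v : outer_shells v -> (`|v.1| + `|v.2| <= `|hexnorm v|)%N.
Proof.
case: v => k l; rewrite /outer_shells /hexnorm /= => h.
set n := k ^+ 2 + _ + _ in h *.
have h2 : (`|k| + `|l|) ^+ 2 <= 4 * n.
  have := sqr_ge0 (k + l); have := sqr_ge0 k; have := sqr_ge0 l.
  by rewrite /n; case: (ger0P k); case: (ger0P l) => *; nia.
have : `|k| + `|l| <= n by nia.
lia.
Qed.
Lemma outer_shells_nat v : outer_shells v ->
  exists n : nat, [/\ hexnorm v = n%:Z, (3 <= n)%N & (`|v.1| + `|v.2| <= n)%N].
Proof.
move=> vO; exists `|hexnorm v|%N; have := l1_le_hexnorm vO.
by move: vO; rewrite /outer_shells /=; split; lia.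
Qed.
End Eis.

(** * Gaussian sums in Selling's coordinates *)

Section Form.
Context {R : realType}.
Implicit Types (u p q r : R) (v : int * int).

Definition selling_form p q r v : R :=
  p * v.1%:~R ^+ 2 + q * v.2%:~R ^+ 2 + r * (v.1 + v.2)%:~R ^+ 2.

Lemma selling_form_hex v : selling_form (1 / 2) (1 / 2) (1 / 2) v = (hexnorm v)%:~R.
Proof. by rewrite /selling_form /hexnorm !(rmorphD, rmorphM, rmorphXn)/=; field. Qed.

(** [turn] permutes the squares of k, l and k + l cyclically, so every coefficient
    meets every square. *)
Lemma selling_form_turn_sum p q r v :
  selling_form p q r v + selling_form p q r (turn v) + selling_form p q r (turn (turn v)) =
  2 * (p + q + r) * (hexnorm v)%:~R.
Proof.
rewrite /selling_form /hexnorm /turn /= !(rmorphD, rmorphN, rmorphM, rmorphXn)/=; ring.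
Qed.

(** The difference is the form with coefficients p - 1/4, q - 1/4, r - 1/4, whose
    determinant is (15/8 - S) / 2. *)
Lemma selling_form_ge_half p q r v : p * q + q * r + r * p = 3 / 4 ->
  1 / 2 < p + r -> p + q + r <= 15 / 8 -> (hexnorm v)%:~R / 2 <= selling_form p q r v.
Proof.
move=> D h S; rewrite -selling_form_hex /selling_form !rmorphD/=.
set k := _%:~R; set l := _%:~R.
pose a := p + r - 1 / 2.
have a0 : 0 < a by rewrite /a; lra.
rewrite -subr_ge0 -(pmulr_rge0 _ a0).
have : 0 <= (a * k + (r - 1 / 4) * l) ^+ 2 by rewrite sqr_ge0.
have : 0 <= (15 / 8 - (p + q + r)) * l ^+ 2 by rewrite mulr_ge0 ?sqr_ge0// subr_ge0.
have := congr1 (fun x => x * l ^+ 2) D.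
by rewrite /a; lra.
Qed.

Definition gsum u p q r : \bar R :=
  (\esum_(v in [set: int * int]) (phi u (selling_form p q r v))%:E)%E.

Local Open Scope ereal_scope.

Lemma gsum_split u p q r : gsum u p q r =
  (2 * (phi u (p + q) + phi u (p + r) + phi u (q + r)))%:E +
  \esum_(v in outer_shells) (phi u (selling_form p q r v))%:E.
Proof.
rewrite /gsum (esumID outer_shells); last by move=> v _; rewrite lee_fin phi_ge0.
rewrite !setTI addeC; congr (_ + _).
rewrite outer_shellsC esum_fset; [|exact: finite_seq|by move=> v _; rewrite lee_fin phi_ge0].
rewrite -fsbig_seq//; transitivity (\sum_(v <- small_vectors) (phi u (selling_form p q r v))%:E) => //.
rewrite sumEFin !big_cons big_nil; congr (_%:E).
have phi0 : phi u 0 = 0%R by rewrite /phi expr0n mul0r.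
rewrite /selling_form /= !rmorphD !rmorphN !rmorph1 !rmorph0/=.
rewrite !(sqrrN, expr1n, expr0n, addr0, add0r, mulr0, mulr1, addrN, addNr)/=.
rewrite phi0 (addrC q r); ring.
Qed.

Lemma esum_outer_shells_turn (f : int * int -> \bar R) :
  \esum_(v in outer_shells) f (turn v) = \esum_(v in outer_shells) f v.
Proof. by rewrite [RHS](reindex_esum outer_shells _ turn)//; exact: turn_bij. Qed.

(** The tangents at the points of a [turn]-orbit have the same slope, and the relative
    displacements y / N - 1 add up to 2S - 3 there.  Summing over orbits amounts to
    comparing three copies of both sums. *)
Lemma outer_shells_ge u p q r (S := (p + q + r)%R) : (271 / 50 <= u)%R ->
  (p * q + q * r + r * p = 3 / 4)%R ->
  (1 / 2 < p + r)%R -> (3 <= 2 * S)%R -> (S <= 15 / 8)%R ->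
  \esum_(v in outer_shells) (phi u (hexnorm v)%:~R)%:E <=
  \esum_(v in outer_shells) (phi u (selling_form p q r v))%:E + ((2 * S - 3) / 10)%:E.
Proof.
move=> hu D h1 h2 h3.
pose d := (2 * S - 3)%R; have d0 : (0 <= d)%R by rewrite /d; lra.
pose c v : R := (3 / 100 * d * 2^-1 ^+ (`|v.1| + `|v.2|)%N)%R.
set H := \esum_(v in outer_shells) (phi u (hexnorm v)%:~R)%:E.
set F := \esum_(v in outer_shells) (phi u (selling_form p q r v))%:E.
have F0 : 0 <= F by apply: esum_ge0 => v _; rewrite lee_fin phi_ge0.
have H0 : 0 <= H by apply: esum_ge0 => v _; rewrite lee_fin phi_ge0.
have cle : \esum_(v in outer_shells) (c v)%:E <= (27 / 100 * d)%:E.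
  have -> : (27 / 100 * d = 9 * (3 / 100 * d))%R by field.
  apply: le_trans (esum_half_int2 _); last by rewrite mulr_ge0.
  rewrite esum_mkcond; apply: le_esum => v _; case: ifP => // _.
  by rewrite lee_fin !mulr_ge0 ?exprn_ge0.
have key : H + (H + H) <= F + (F + F) + (27 / 100 * d)%:E.
  apply: le_trans (leeD2l _ cle).
  rewrite -[X in _ <= F + (F + X) + _]esum_outer_shells_turn.
  rewrite -[X in _ <= F + (F + X) + _]esum_outer_shells_turn.
  rewrite -[X in _ <= F + (X + _) + _]esum_outer_shells_turn.
  rewrite /F /H -!esumD; try by move=> v _; rewrite ?adde_ge0// lee_fin ?phi_ge0// !mulr_ge0 ?exprn_ge0.
  apply: le_esum => v vO; rewrite -!EFinD lee_fin.
  have [n [vn n3 l1n]] := outer_shells_nat vO; rewrite vn.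
  have N3 : (3 <= n%:R :> R)%R by rewrite ler_nat.
  have N0 : (n%:R != 0 :> R)%R by rewrite pnatr_eq0; lia.
  have tail := outer_term_le hu n3.
  have tan w : hexnorm w = n%:Z -> (phi u n%:R - (selling_form p q r w / n%:R - 1) * ((u * n%:R - 2) * phi u n%:R)
      <= phi u (selling_form p q r w))%R.
    move=> wn; apply: phi_ge_tangent => //.
    by have := selling_form_ge_half w D h1 h3; rewrite wn.
  have t1 := tan v vn; have t2 := tan (turn v); have t3 := tan (turn (turn v)).
  rewrite !hexnorm_turn in t2 t3; have {}t2 := t2 vn; have {}t3 := t3 vn.
  have := selling_form_turn_sum p q r v; rewrite vn => E.
  have {}E : ((selling_form p q r v / n%:R - 1) + (selling_form p q r (turn v) / n%:R - 1)
     + (selling_form p q r (turn (turn v)) / n%:R - 1) = d)%R.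
    rewrite (_ : _ + _ = (selling_form p q r v + selling_form p q r (turn v) + selling_form p q r (turn (turn v))) / n%:R - 3)%R; last by ring.
    by rewrite E /d /S; field.
  have cv : (d * ((u * n%:R - 2) * phi u n%:R) <= c v)%R.
    rewrite /c (mulrC (3 / 100)%R) -mulrA ler_wpM2l//; apply: le_trans tail _.
    by rewrite ler_wpM2l// ler_wiXn2l//; lra.
  rewrite -E in cv; rewrite -?[n%:~R]/(n%:R); lra.
clear cle.
case: F F0 key => [f| |]//; rewrite ?leey// lee_fin => f0.
case: H H0 => [h| |]//; rewrite lee_fin => _.
rewrite -!EFinD !lee_fin /d; lra.
Qed.

(** Up to the factor u n - 2 >= 14, the terms are those of [outer_term_le]. *)
Lemma outer_shells_hex_le u : (271 / 50 <= u)%R ->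
  \esum_(v in outer_shells) (phi u (hexnorm v)%:~R)%:E <= (2 / 100)%:E.
Proof.
move=> hu; have c0 : (0 <= 3 / 1400 :> R)%R by lra.
apply: le_trans (_ : _ <= (9 * (3 / 1400))%:E) _; last by rewrite lee_fin; lra.
apply: le_trans (esum_half_int2 c0).
rewrite esum_mkcond; apply: le_esum => v _; case: ifP => [|_]; last first.
  by rewrite lee_fin mulr_ge0// exprn_ge0.
rewrite inE lee_fin => vO.
have [n [vn n3 l1n]] := outer_shells_nat vO; rewrite vn.
have N3 : (3 <= n%:R :> R)%R by rewrite ler_nat.
have le2 : (2^-1 ^+ n <= 2^-1 ^+ (`|v.1| + `|v.2|) :> R)%R by rewrite ler_wiXn2l//; lra.
have /= := outer_term_le hu n3.
have : (14 * phi u n%:R <= (u * n%:R - 2) * phi u n%:R)%R.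
  by rewrite ler_wpM2r ?phi_ge0//; nra.
lra.
Qed.
End Form.

(** * Comparison for reduced forms *)

Section Reduce.
Context {R : realType}.
Implicit Types (u p q r x : R) (v w : int * int).

Lemma phi1 u : phi u 1 = 1.
Proof. by rewrite /phi expr1n mul1r subrr mulr0 oppr0 expR0. Qed.

Lemma gsum_hex u : gsum u (1 / 2) (1 / 2) (1 / 2) =
  (6%:E + \esum_(v in outer_shells) (phi u (hexnorm v)%:~R)%:E)%E.
Proof.
rewrite gsum_split (_ : 1 / 2 + 1 / 2 = 1); last by field.
rewrite phi1 (_ : 2 * _ = 6); last by ring.
by congr (_ + _)%E; apply: eq_esum => v _; rewrite selling_form_hex.
Qed.

Lemma gsum_hex_le u : 271 / 50 <= u ->
  (gsum u (1 / 2) (1 / 2) (1 / 2) <= (6 + 2 / 100)%:E)%E.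
Proof. by move=> hu; rewrite gsum_hex (EFinD 6) leeD2l// outer_shells_hex_le. Qed.

Lemma gsum_ge_seq u p q r (s : seq (int * int)) : uniq s ->
  ((\sum_(v <- s) phi u (selling_form p q r v))%:E <= gsum u p q r)%E.
Proof.
move=> us; apply: esum_ge; exists [set` s]; first by split=> //; exact: finite_seq.
by rewrite -fsbig_seq// -sumEFin.
Qed.

Lemma selling_form_scale p q r v (j : int) :
  selling_form p q r (j * v.1, j * v.2) = j%:~R ^+ 2 * selling_form p q r v.
Proof. by rewrite /selling_form /= -mulrDr !rmorphM/=; ring. Qed.

Lemma gsum_ge_multiples u p q r v (js : seq int) : v != (0, 0) -> uniq js ->
  ((\sum_(j <- js) phi u (j%:~R ^+ 2 * selling_form p q r v))%:E <= gsum u p q r)%E.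
Proof.
move=> v0 js_uniq.
have inj : injective (fun j : int => (j * v.1, j * v.2)).
  case: v v0 => k l v0 i j /= [/eqP ki /eqP li]; apply/eqP; rewrite -subr_eq0.
  move: ki li; rewrite -subr_eq0 -mulrBl mulf_eq0 -(subr_eq0 (i * l)) -mulrBl mulf_eq0.
  case/orP=> [->//|/eqP k0] /orP[//|/eqP l0].
  by move: v0; rewrite k0 l0 eqxx.
have := gsum_ge_seq u p q r (_ : uniq [seq (j * v.1, j * v.2) | j <- js]).
rewrite map_inj_uniq// => /(_ js_uniq); apply: le_trans.
by rewrite big_map lee_fin; apply: ler_sum => j _; rewrite selling_form_scale.
Qed.

(** Let x be the norm of the short vector and j the largest integer such that
    j^2 x <= 62/100.  For j >= 2 maximality forces j^2 x > 62/100 * 4/9 > 21/100, and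
    the two vectors of norm j^2 x are enough.  For j = 1 the norm may be too
    small, and then the vectors of norm 4 x help. *)
Lemma gsum_short u p q r v : 271 / 50 <= u -> v != (0, 0) ->
  0 < selling_form p q r v -> selling_form p q r v < 62 / 100 ->
  (gsum u (1 / 2) (1 / 2) (1 / 2) <= gsum u p q r)%E.
Proof.
move=> hu v0; set x := selling_form p q r v => x0 x1.
apply: le_trans (gsum_hex_le hu) _.
have one (j : nat) : (0 < j)%N -> 3011 / 1000 <= phi u (j%:R ^+ 2 * x) ->
    ((6 + 2 / 100)%:E <= gsum u p q r)%E.
  move=> j0 h; apply: le_trans (gsum_ge_multiples u p q r v0 (js := [:: j%:Z; - j%:Z]) _).
    by rewrite !big_cons big_nil rmorphN sqrrN/= lee_fin -/x; lra.
  by rewrite /= inE andbT; lia.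
have two : 3011 / 1000 <= phi u x + phi u (4 * x) ->
    ((6 + 2 / 100)%:E <= gsum u p q r)%E.
  move=> h; apply: le_trans (gsum_ge_multiples u p q r v0 (js := [:: 1; -1; 2; -2]) _) => //.
  rewrite !big_cons big_nil !rmorphN !sqrrN/= lee_fin -/x.
  rewrite !expr1n !mul1r (_ : 2%:~R ^+ 2 = 4); last by rewrite -[2%:~R]/(2%:R); ring.
  by lra.
have [j j_le j_max] : exists2 j : nat, j%:R ^+ 2 * x <= 62 / 100 &
    forall i : nat, i%:R ^+ 2 * x <= 62 / 100 -> (i <= j)%N.
  have ex : exists i : nat, i%:R ^+ 2 * x <= 62 / 100.
    by exists 0%N; rewrite expr0n mul0r; lra.
  pose M := Num.bound x^-1.
  have ub i : i%:R ^+ 2 * x <= 62 / 100 -> (i <= M)%N.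
    move=> hi; rewrite leqNgt; apply/negP => Mi.
    have hM : x^-1 < M%:R.
      by apply: archi_boundP; rewrite invr_ge0 ltW.
    have h1 : 1 < M%:R * x by rewrite -ltr_pdivrMr// mul1r.
    have h2 : M%:R <= i%:R :> R by rewrite ler_nat ltnW.
    have h3 : 1 <= i%:R :> R by rewrite (ler_nat _ 1) (leq_trans _ Mi).
    have h4 := ler_wpM2r (ltW x0) h2.
    have : 0 <= i%:R * (i%:R - 1) * x by rewrite !mulr_ge0 ?subr_ge0// ltW.
    lra.
  by case: (ex_maxnP ex ub) => j j1 j2; exists j.
have j0 : (0 < j)%N by apply: j_max; rewrite expr1n mul1r ltW.
have j1 : 62 / 100 < j.+1%:R ^+ 2 * x.
  by rewrite ltNge; apply/negP => /j_max; rewrite ltnn.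
case: j j0 j_le j1 {j_max} => [//|[|j]] _ j_le j1.
  have [h|h] := lerP (21 / 100) x.
    by apply: (one 1%N) => //; rewrite expr1n mul1r; apply: phi_ge_single => //; lra.
  by apply: two; apply: phi_ge_double; lra.
apply: (one j.+2) => //; apply: phi_ge_single => //.
have : 4 * j.+3%:R ^+ 2 <= 9 * j.+2%:R ^+ 2 :> R.
  by have : 0 <= j%:R :> R by []; rewrite -!natr1; nra.
by move=> /(ler_wpM2r (ltW x0)); lra.
Qed.

(** The margin of [first_shell_ge], counted twice because vectors come in opposite
    pairs, is exactly the loss allowed by [outer_shells_ge]. *)
Lemma gsum_long u p q r : 271 / 50 <= u -> p * q + q * r + r * p = 3 / 4 ->
  p <= q -> p <= r -> - (1 / 1000) <= p ->
  62 / 100 <= p + q -> 62 / 100 <= p + r ->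
  (gsum u (1 / 2) (1 / 2) (1 / 2) <= gsum u p q r)%E.
Proof.
move=> hu D pq pr p0 h1 h2.
have [hS h3] := reduced_bounds D pq pr p0 h1 h2.
have S3 : 3 <= 2 * (p + q + r) by apply: selling_sum_ge; lra.
have F : 3 + (2 * (p + q + r) - 3) / 20 <= phi u (p + q) + phi u (p + r) + phi u (q + r).
  by apply: first_shell_ge; lra.
rewrite gsum_hex gsum_split.
have O : (_ <= _)%E := outer_shells_ge hu D (_ : 1 / 2 < p + r) S3 hS.
apply: le_trans (leeD2l _ (O _)) _; first lra.
by rewrite addeCA [leRHS]addeC leeD2l// -EFinD lee_fin; lra.
Qed.
End Reduce.

(** * Selling's reduction *)

Section Selling.
Context {R : realType}.
Implicit Types (u p q r x : R) (v w : int * int).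

Lemma gsum_reindex u p q r p' q' r' (f g : int * int -> int * int) :
  cancel f g -> cancel g f -> (forall v, selling_form p q r (f v) = selling_form p' q' r' v) ->
  gsum u p q r = gsum u p' q' r'.
Proof.
move=> fg gf E; rewrite /gsum (reindex_esum [set: int * int] _ f).
  by apply: eq_esum => v _; rewrite E.
by split=> // [v w _ _ /(can_inj fg)|v _]//; exists (g v).
Qed.

Lemma gsum_swap u p q r : gsum u p q r = gsum u q p r.
Proof.
apply: (gsum_reindex _ (f := fun v => (v.2, v.1)) (g := fun v => (v.2, v.1))).
- by case.
- by case.
- by case=> k l; rewrite /selling_form /= addrC; ring.
Qed.

Lemma gsum_flip u p q r : gsum u p q r = gsum u r q p.
Proof.
apply: (gsum_reindex _ (f := fun v => (v.1 + v.2, - v.2)) (g := fun v => (v.1 + v.2, - v.2))).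
- by case=> k l /=; rewrite addrK opprK.
- by case=> k l /=; rewrite addrK opprK.
- by case=> k l; rewrite /selling_form /= addrK !(rmorphD, rmorphN)/=; ring.
Qed.

(** The change of superbase in Selling's algorithm.  It replaces S by S + 2 p, so it
    makes S smaller when p is negative. *)
Lemma gsum_step u p q r : gsum u p q r = gsum u (q + 2 * p) (r + 2 * p) (- p).
Proof.
apply: (gsum_reindex _ (f := fun v => (v.2 - v.1, v.1)) (g := fun v => (v.2, v.1 + v.2))).
- by case=> k l /=; rewrite subrK.
- by case=> k l /=; rewrite addrK.
- by case=> k l; rewrite /selling_form /= !(rmorphD, rmorphN)/=; ring.
Qed.

(** Only the value of the Gaussian sum is recorded, not the change of basis.  The
    first two conditions make the form positive definite. *)
Definition selling_equiv u (G : \bar R) p q r :=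
  [/\ p * q + q * r + r * p = 3 / 4, 0 < p + q & gsum u p q r = G].

(** (p + q) (p + r) = p^2 + 3/4 and (p + q) (q + r) = q^2 + 3/4. *)
Lemma selling_equiv_pos u G p q r : selling_equiv u G p q r ->
  0 < p + r /\ 0 < q + r.
Proof.
case=> D h _; rewrite -(pmulr_rgt0 (p + r) h) -(pmulr_rgt0 (q + r) h).
by have := sqr_ge0 p; have := sqr_ge0 q; lra.
Qed.

Lemma selling_equiv_swap u G p q r : selling_equiv u G p q r -> selling_equiv u G q p r.
Proof. by move=> [D h E]; split; [lra|lra|rewrite -gsum_swap]. Qed.

Lemma selling_equiv_flip u G p q r : selling_equiv u G p q r -> selling_equiv u G r q p.
Proof.
move=> K; have [_ h] := selling_equiv_pos K.
by case: K => D _ E; split; [lra|lra|rewrite -gsum_flip].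
Qed.

Lemma selling_equiv_step u G p q r : selling_equiv u G p q r ->
  selling_equiv u G (q + 2 * p) (r + 2 * p) (- p).
Proof.
move=> K; have [h1 h2] := selling_equiv_pos K.
case: K => D h E; split; [lra| |by rewrite -gsum_step].
by rewrite -(pmulr_rgt0 _ h2); have := sqr_ge0 (q - r); lra.
Qed.

(** Instead of running Selling's algorithm to its end, take an equivalent form whose
    sum S is within 2 e of the infimum: a coefficient below - e would allow a step
    that goes below the infimum. *)
Lemma selling_reduction u G p q r e : 0 < e -> selling_equiv u G p q r ->
  exists p' q' r', selling_equiv u G p' q' r' /\
    [/\ - e <= p', - e <= q' & - e <= r'].
Proof.
move=> e0 K.
pose E := [set s | exists p q r, selling_equiv u G p q r /\ s = p + q + r].
have lbE : lbound E 0.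
  move=> _ [a [b [c [Kabc ->]]]].
  by have [? ?] := selling_equiv_pos Kabc; case: Kabc => _ ? _; lra.
have hE : has_inf E by split; [exists (p + q + r); exists p, q, r|exists 0].
have e20 : 0 < 2 * e by lra.
have [_ [a [b [c [Kabc ->]]]] lt_inf] := inf_adherent e20 hE.
have first_ge a' b' c' : selling_equiv u G a' b' c' -> a' + b' + c' = a + b + c -> - e <= a'.
  move=> K' S'; have Estep : E (b' + 2 * a' + (c' + 2 * a') + - a').
    exists (b' + 2 * a'), (c' + 2 * a'), (- a').
    by split=> //; exact: selling_equiv_step.
  by have := ge_inf (ex_intro _ 0 lbE) Estep; lra.
exists a, b, c; split=> //; split.
- exact: (first_ge a b c).
- by apply: (first_ge b a c); [exact: selling_equiv_swap|ring].
- by apply: (first_ge c b a); [exact: selling_equiv_flip|ring].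
Qed.

Theorem gsum_min u p q r : 271 / 50 <= u ->
  p * q + q * r + r * p = 3 / 4 -> 0 < p + q ->
  (gsum u (1 / 2) (1 / 2) (1 / 2) <= gsum u p q r)%E.
Proof.
move=> hu D pq0.
have K0 : selling_equiv u (gsum u p q r) p q r by split.
have e0 : 0 < 1 / 1000 :> R by lra.
have [a [b [c [K [ha hb hc]]]]] := selling_reduction e0 K0.
move: (gsum u p q r) K => G K {p q r D pq0 K0}.
have [h2 h3] := selling_equiv_pos K; case: (K) => D h1 <-.
have v1 : selling_form a b c (1, -1) = a + b.
  by rewrite /selling_form /= subrr rmorphN; ring.
have v2 : selling_form a b c (1, 0) = a + c by rewrite /selling_form /= addr0; ring.
have v3 : selling_form a b c (0, 1) = b + c by rewrite /selling_form /= add0r; ring.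
have [s1|s1] := ltrP (a + b) (62 / 100).
  by apply: (gsum_short hu (v := (1, -1))) => //; rewrite v1.
have [s2|s2] := ltrP (a + c) (62 / 100).
  by apply: (gsum_short hu (v := (1, 0))) => //; rewrite v2.
have [s3|s3] := ltrP (b + c) (62 / 100).
  by apply: (gsum_short hu (v := (0, 1))) => //; rewrite v3.
have [ab|ab] := lerP a b.
  have [ac|ac] := lerP a c; first by apply: gsum_long.
  by rewrite gsum_flip; apply: gsum_long; lra.
have [bc|bc] := lerP b c.
  by rewrite gsum_swap; apply: gsum_long; lra.
by rewrite gsum_flip; apply: gsum_long; lra.
Qed.
End Selling.

(** * From lattices to Selling's coordinates *)

Section Link.
Context {R : realType}.

Lemma esumZl_le (T : choiceType) (I : set T) (c : R) (f : T -> R) :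
  (forall i, 0 <= f i) -> 0 <= c ->
  (\esum_(i in I) (c * f i)%:E <= c%:E * \esum_(i in I) (f i)%:E)%E.
Proof.
move=> f0 c0; apply: ge_ereal_sup => _ [X [finX XI] <-].
under eq_fsbigr do rewrite EFinM.
rewrite -ge0_mule_fsumr; last by move=> i; rewrite lee_fin f0.
by rewrite lee_wpmul2l//; apply: ereal_sup_ubound; exists X.
Qed.

(** Apply [esumZl_le] to c and to its inverse. *)
Lemma esumZl (T : choiceType) (I : set T) (c : R) (f : T -> R) :
  (forall i, 0 <= f i) -> 0 < c ->
  (\esum_(i in I) (c * f i)%:E = c%:E * \esum_(i in I) (f i)%:E)%E.
Proof.
move=> f0 c0; apply/eqP; rewrite eq_le (esumZl_le _ f0 (ltW c0))/=.
have cK : (c%:E * (c^-1)%:E = 1)%E by rewrite -EFinM divff// gt_eqF.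
rewrite -[leRHS]mul1e -cK -muleA lee_pmul2l ?fin_numE// ?lte_fin//.
have cf i : 0 <= c * f i by rewrite mulr_ge0// ltW.
apply: le_trans (esumZl_le I cf (_ : 0 <= c^-1)); last by rewrite invr_ge0 ltW.
by apply: le_esum => i _; rewrite mulKf// gt_eqF.
Qed.

Lemma lattice_pointE (c x y : R) (m n : int) :
  (c%:C * (m%:~R + n%:~R * (x +i* y)))%C =
  ((c * (m%:~R + n%:~R * x)) +i* (c * (n%:~R * y)))%C.
Proof.
have -> : (m%:~R : R[i]%C) = (m%:~R : R)%:C%C by rewrite rmorph_int.
have -> : (n%:~R : R[i]%C) = (n%:~R : R)%:C%C by rewrite rmorph_int.
by simpc.
Qed.

Lemma sqr_normc_lattice_point (x y : R) (m n : int) : 0 < y ->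
  Normc.normc ((Num.sqrt y)^-1%:C * (m%:~R + n%:~R * (x +i* y)))%C ^+ 2 =
  ((m%:~R + n%:~R * x) ^+ 2 + (n%:~R * y) ^+ 2) / y.
Proof.
move=> y0; rewrite lattice_pointE /= sqr_sqrtr ?addr_ge0 ?sqr_ge0//.
by rewrite !exprMn -mulrDr exprVn sqr_sqrtr ?ltW// mulrC.
Qed.

(** |m + n z|^2 / y is the Selling form with p = (1 - x)/y, q = (|z|^2 - x)/y, r = x/y;
    the factor s makes the smallest norm 1 at z = e^(i pi/3). *)
Lemma quartic_gaussian_sumE (alpha x y : R) (s := Num.sqrt 3 / 2) (u := pi * alpha / s) : 0 < y ->
  quartic_gaussian_sum alpha (unit_lattice (x +i* y)%C) =
  ((expR (- u) / s ^+ 2)%:E *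
    gsum u (s * ((1 - x) / y)) (s * ((x ^+ 2 + y ^+ 2 - x) / y)) (s * (x / y)))%E.
Proof.
move=> y0.
have s0 : 0 < s by rewrite /s divr_gt0// sqrtr_gt0.
pose e (v : int * int) : R[i]%C := ((Num.sqrt y)^-1)%:C%C * (v.1%:~R + v.2%:~R * (x +i* y)%C).
have -> : unit_lattice (x +i* y)%C = e @` setT.
  apply/seteqP; split => [_ [m [n ->]]|_ [v _ <-]]; first by exists (m, n).
  by exists v.1, v.2.
rewrite /quartic_gaussian_sum esum_image; last first.
  move=> [m n] [m' n'] _ _; rewrite /e !lattice_pointE /= => -[].
  have c0 : (Num.sqrt y)^-1 != 0 by rewrite invr_eq0 gt_eqF// sqrtr_gt0.
  move=> h1 /(mulfI c0)/(mulIf (lt0r_neq0 y0)) h2.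
  move: h1; rewrite h2 => /(mulfI c0)/addIr/eqP; rewrite eqr_int => /eqP ->.
  by move/eqP: h2; rewrite eqr_int => /eqP ->.
rewrite -esumZl; [|by move=> v; exact: phi_ge0|]; last by rewrite divr_gt0 ?expR_gt0// exprn_gt0.
apply: eq_esum => -[m n] _; congr (_%:E).
rewrite -[4%N]/(2 * 2)%N exprM sqr_normc_lattice_point//=.
set Q := ((_ + _) ^+ 2 + _) / y.
have -> : selling_form (s * ((1 - x) / y)) (s * ((x ^+ 2 + y ^+ 2 - x) / y)) (s * (x / y)) (m, n) = s * Q.
  by rewrite /selling_form /Q /= rmorphD /=; field; rewrite gt_eqF.
rewrite /phi.
have -> : expR (- (pi * alpha * Q)) = expR (- u) * expR (- (u * (s * Q - 1))).
  rewrite -expRD; congr expR; by rewrite /u; field; rewrite gt_eqF.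
by field; rewrite gt_eqF.
Qed.
End Link.

Theorem theorem1p1 (R : realType) (alpha : R) (halpha : 3 / 2 <= alpha) :
  (exists z0 : R[i]%C, is_minimizer alpha z0) /\
  is_minimizer alpha (hexagonal_point R).
Proof.
suff H : is_minimizer alpha (hexagonal_point R) by split=> //; exists (hexagonal_point R).
have s3 : 0 < Num.sqrt 3 :> R by rewrite sqrtr_gt0.
have s32 : Num.sqrt 3 ^+ 2 = 3 :> R by rewrite sqr_sqrtr.
have s0 : 0 < Num.sqrt 3 / 2 :> R by rewrite divr_gt0.
rewrite /is_minimizer /hexagonal_point /expi cos_pi3 sin_pi3; split=> // -[x y] y0.
rewrite !quartic_gaussian_sumE//.
set s := Num.sqrt 3 / 2 in s0 *; set u := _ / s.
have sE : s ^+ 2 = 3 / 4 by rewrite /s; lra.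
have sN : s != 0 by rewrite gt_eqF.
have yN : y != 0 by rewrite gt_eqF.
rewrite lee_pmul2l ?fin_numE//; last by rewrite lte_fin divr_gt0 ?expR_gt0// exprn_gt0.
have hu : 271 / 50 <= u.
  have s_le : s <= 8662 / 10000 by nra.
  have pa : 313 / 100 * (3 / 2) <= pi * alpha by rewrite ler_pM ?pi_ge_313.
  by rewrite /u ler_pdivlMr//; lra.
have -> : s * ((1 - 1 / 2) / s) = 1 / 2 by field.
have -> : s * (1 / 2 / s) = 1 / 2 by field.
have -> : s * (((1 / 2) ^+ 2 + s ^+ 2 - 1 / 2) / s) = 1 / 2 by rewrite sE; field.
apply: gsum_min => //.
  by rewrite -sE; field.
rewrite (_ : _ + _ = s * (((1 - x) ^+ 2 + y ^+ 2) / y)); last by field.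
rewrite mulr_gt0// divr_gt0//.
by rewrite ltr_wpDl ?sqr_ge0// exprn_gt0.
Qed.
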